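(* Let $\gamma\in(0,1]$ and $p=p_n=\lceil\gamma n\rceil$. Suppose that $H$ is the CDF of a compactly supported probability measure on $[0,\infty)$ satisfying $\lim_{y\downarrow\mathcal{Z}_+(H)}\int(y-z)^{-2}dH(z)=\infty$. Let $H_n$ be a sequence of CDFs of compactly supported probability measures on $[0,\infty)$ such that (1) $H_n$ converges weakly to $H$, and (2) $\mathcal{Z}_+(H_n)\to\mathcal{Z}_+(H)$. Then $T_{p/n}(H_n)\to T_\gamma(H)$ as $n\to\infty$.
   Context: For a CDF $H$ of a compactly supported probability measure on $[0,\infty)$ let $\mathcal{Z}_+(H)=\sup\{z:H(z)<1\}$. For $c\in(0,1]$ and $y>\mathcal{Z}_+(H)$ let $\varphi(y;H)=\int\frac{y}{y^2-z^2}dH(z)$, $\tilde\varphi_c(y;H)=c\,\varphi(y;H)+\frac{1-c}{y}$, $\mathcal{D}_c(y;H)=\varphi(y;H)\tilde\varphi_c(y;H)$, with $y$-derivative $\mathcal{D}_c'(y;H)$. Define $\Psi_c(y;H)=y\,\mathcal{D}_c'(y;H)/\mathcal{D}_c(y;H)$ and $T_c(H)=\inf\{y:\ y>\mathcal{Z}_+(H)\text{ and }\Psi_c(y;H)\ge-4\}$. *)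

(* Defs.v *)
From HB Require Import structures.
From mathcomp Require Import all_boot all_order all_algebra.
From mathcomp Require Import all_classical all_reals all_analysis.

Set Implicit Arguments.
Unset Strict Implicit.
Unset Printing Implicit Defensive.

Import Order.TTheory GRing.Theory Num.Theory.
Import numFieldNormedType.Exports.

Local Open Scope classical_set_scope.
Local Open Scope ring_scope.

(* A CDF is a [cumulativeBounded 0 1]: nondecreasing, right-continuous on the
   whole real line, with limits 0 at -oo and 1 at +oo. Integration against [dH]
   is integration against its Lebesgue-Stieltjes probability measure. *)
Notation CDF R := (cumulativeBounded (0 : R) (1 : R)).

Definition compactly_supported_nneg (R : realType) (H : CDF R) : Prop :=
  exists M : R, lebesgue_stieltjes_measure H `[0, M] = 1%E.

Definition cdf_weak_cvg (R : realType) (Hn : nat -> CDF R) (H : CDF R) : Prop :=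
  forall x : R, {for x, continuous H} -> Hn n x @[n --> \oo] --> H x.

(* [z] ranges over all of [R], so that the Dirac mass at 0 has [Zplus] = 0
   rather than the supremum of an empty set. *)
Definition Zplus (R : realType) (H : CDF R) : R := sup [set z : R | H z < 1].

Definition phi (R : realType) (H : CDF R) (y : R) : R :=
  \int[lebesgue_stieltjes_measure H]_(z in setT) (y / (y ^+ 2 - z ^+ 2)).

Definition phi_tilde (R : realType) (c : R) (H : CDF R) (y : R) : R :=
  c * phi H y + (1 - c) / y.

Definition Dtransform (R : realType) (c : R) (H : CDF R) (y : R) : R :=
  phi H y * phi_tilde c H y.

Definition Psi (R : realType) (c : R) (H : CDF R) (y : R) : R :=
  y * derive1 (Dtransform c H) y / Dtransform c H y.

Definition Tthreshold (R : realType) (c : R) (H : CDF R) : R :=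
  inf [set y : R | Zplus H < y /\ - 4 <= Psi c H y].

(* Main.v *)
Require Import Defs.
From HB Require Import structures.
From mathcomp Require Import all_boot all_order all_algebra.
From mathcomp Require Import all_classical all_reals all_analysis.
From mathcomp Require Import measurable_realfun ring lra.

Set Implicit Arguments.
Unset Strict Implicit.
Unset Printing Implicit Defensive.

Import Order.TTheory GRing.Theory Num.Theory.
Import numFieldNormedType.Exports.

Local Open Scope classical_set_scope.
Local Open Scope ring_scope.

(** Put [R(y,z) = 1/(y^2 - z^2)], let [m_j(y)] be the integral of [R(y,z)^j]
    against [dH(z)], and let [G = y^2 m_1]. Differentiating [m_1] under the
    integral sign turns [Psi_c] into [-2 (1 + W_c)], where
      [W_c(y) = (y^2 m_2 / m_1 - 1) (1 + c G / (c G + 1 - c))]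
    ([edge_excess], [PsiE]). The condition [Psi_c >= -4] therefore reads
    [W_c <= 1].

    The key point is that [y^2 W_c(y)] is nonincreasing for [y > Z_+]
    ([edge_excess_sqr_nonincreasing]). The second factor of [W_c] is
    nonincreasing because [G] is. As for the first one,
    [y^2 (y^2 m_2 / m_1 - 1)] is the mean of [y^2 z^2 / (y^2 - z^2)] under the
    measure of density [R / m_1] with respect to [H]. When [y] decreases, this
    function of [z] increases, and the measure tilts towards large [z], where
    the function is larger ([moment_ratio_nonincreasing]). Hence the set
    [W_c <= 1] is closed upwards in the half-line [y > Z_+], it is nonempty
    since [W_c = O(y^-2)], and [W_c < 1] strictly above each of its points
    ([edge_excess_lt1]). In particular the graph of [W_c] cannot stay at level 1
    on an interval, which is what makes its crossing point stable.

    For fixed [y > Z_+(H)], choose [b] between [Z_+(H)] and [y]. The interval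
    [0, b] carries [H] and, as [Z_+(H_n)] tends to [Z_+(H)], eventually every
    [H_n]; on it [R(y,.)] is Lipschitz, so weak convergence gives convergence
    of [m_1] and [m_2] by the Helly-Bray theorem ([helly_bray_lipschitz]), and
    then [W_{c_n}(y; H_n)] tends to [W_c(y; H)] ([cvg_edge_excess]).

    Pointwise convergence is enough ([cvg_Tthreshold]): just above [T] the limit
    satisfies [W_c < 1], so eventually [T(H_n)] is at most that point; just below
    [T], and still above [Z_+], it satisfies [W_c > 1], so upward closure puts
    [T(H_n)] above that point; and if [T = Z_+], the lower bound is
    [T(H_n) >= Z_+(H_n)]. *)

(** * Distribution functions and their measures *)

Local Notation LS := lebesgue_stieltjes_measure.

Section CDF.
Context {R : realType}.
Implicit Types (K : CDF R) (x y z b : R).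

Lemma CDF_le1 K x : K x <= 1.
Proof. by rewrite -lee_fin -cdf_lebesgue_stieltjes_id; exact: probability_le1. Qed.

Lemma CDF_nondecreasing K x y : x <= y -> K x <= K y.
Proof. exact: cumulative_is_nondecreasing. Qed.

Lemma LS_itvNyc K x : LS K `]-oo, x] = (K x)%:E.
Proof.
by rewrite -cdf_lebesgue_stieltjes_id /cdf /distribution /pushforward preimage_id.
Qed.

Lemma LS_itvoc K x y : x <= y -> LS K `]x, y] = (K y - K x)%:E.
Proof.
move=> xy; rewrite /lebesgue_stieltjes_measure /measure_extension.
by rewrite measurable_mu_extE/= ?wlength_itv_bnd//; exact: is_ocitv.
Qed.

(** The discontinuities of a nondecreasing function are countable, hence cannot
    fill an interval of positive Lebesgue measure. *)
Lemma dense_continuity_points K (u v : R) : u < v ->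
  exists2 x, u < x < v & {for x, continuous K}.
Proof.
move=> uv; have ndK := @CDF_nondecreasing K.
pose D : set R := [set x | x \in (`]u, v[) /\ discontinuity K x].
have cD : countable D.
  by apply: discontinuity_countable => x y _ _; exact: ndK.
have [x xuv xD] : exists2 x, x \in (`]u, v[) & ~ discontinuity K x.
  apply/not_exists2P => h.
  have : (lebesgue_measure `]u, v[ <= lebesgue_measure D)%E.
    apply: le_measure; rewrite ?inE//.
      exact: countable_measurable.
    by move=> x xuv; split => //; have [|/contrapT] := h x.
  rewrite (countable_lebesgue_measure0 cD) lebesgue_measure_itv/= lte_fin uv.
  by rewrite -EFinB lee_fin subr_le0 leNgt uv.
exists x; first by move: xuv; rewrite in_itv.
have rK : K t @[t --> x^'+] --> K x := @cumulative_is_right_continuous _ _ _ K x.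
have lK : cvg (K t @[t --> x^'-]).
  apply: nondecreasing_at_left_is_cvgr.
    by near=> t => s r _ _; exact: ndK.
  near=> t; exists (K x) => _ [s /= + <-].
  by rewrite in_itv/= => /andP[_ /ltW]; exact: ndK.
apply/left_right_continuousP; split => //.
have [<-|nE] := eqVneq (lim (K t @[t --> x^'-])) (K x); first exact: lK.
case: xD; split => //; first by apply/cvg_ex; exists (K x).
by rewrite (cvg_lim _ rK).
Unshelve. all: end_near. Qed.

End CDF.

(** * Measures carried by a compact interval *)

Section Support.
Context {R : realType}.
Implicit Types (K : CDF R) (x y z b : R).

Lemma LS_setC_concentrated K b : LS K `[0, b] = 1%E -> LS K (~` `[0, b]) = 0%E.
Proof.
move=> Kb; have /= -> := probability_setC (LS K) (measurable_itv `[0, b]).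
by rewrite Kb subee.
Qed.

Lemma concentrated_Iio K b : LS K `[0, b] = 1%E -> LS K `]-oo, 0[ = 0%E.
Proof.
move=> Kb; apply/eqP; rewrite eq_le measure_ge0 andbT.
rewrite -(LS_setC_concentrated Kb).
apply: le_measure; rewrite ?inE//; first exact: measurableC.
by move=> x /=; rewrite !in_itv/= => x0 /andP[/(lt_le_trans x0)]; rewrite ltxx.
Qed.

Lemma concentrated_lt0 K b z : LS K `[0, b] = 1%E -> z < 0 -> K z = 0.
Proof.
move=> Kb z0; have : (LS K `]-oo, z] <= LS K `]-oo, 0%R[)%E.
  rewrite le_measure ?inE// => x /=.
  by rewrite !in_itv/= => /le_lt_trans; exact.
rewrite (concentrated_Iio Kb) LS_itvNyc lee_fin => Kz.
by apply/eqP; rewrite eq_le Kz -lee_fin -LS_itvNyc measure_ge0.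
Qed.

Lemma concentrated_ge0 K b : LS K `[0, b] = 1%E -> 0 <= b.
Proof.
move=> Kb; rewrite leNgt; apply/negP => b0; move: Kb.
by rewrite set_itv_ge ?bnd_simp -?ltNge// measure0 => /eqP; rewrite eqe eq_sym oner_eq0.
Qed.

Lemma concentrated_edge K b : LS K `[0, b] = 1%E -> K b = 1.
Proof.
move=> Kb; apply/eqP; rewrite eq_le CDF_le1/= -lee_fin -LS_itvNyc -Kb.
by apply: le_measure; rewrite ?inE//; exact: subset_itvr.
Qed.

Lemma has_ubound_lt1 K : compactly_supported_nneg K ->
  has_ubound [set z : R | K z < 1].
Proof.
move=> [M KM]; exists M => z /= Kz; rewrite leNgt; apply/negP => /ltW Mz.
have := CDF_nondecreasing K Mz.
by rewrite (concentrated_edge KM) leNgt Kz.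
Qed.

Lemma Zplus_ge0 K : compactly_supported_nneg K -> 0 <= Zplus K.
Proof.
move=> sK; rewrite leNgt; apply/negP => Z0.
have [M KM] := sK.
have : Zplus K / 2 <= Zplus K.
  apply: (ub_le_sup (has_ubound_lt1 sK)) => /=.
  by rewrite (concentrated_lt0 KM)//; lra.
lra.
Qed.

(** This is how [Zplus] enters every later argument: any [b] above it bounds the
    support, so that integrals can be taken over the compact [0, b]. *)
Lemma concentrated_gt_Zplus K b : compactly_supported_nneg K ->
  Zplus K < b -> LS K `[0, b] = 1%E.
Proof.
move=> sK Zb; have [M KM] := sK.
have b0 : 0 <= b by rewrite (le_trans (Zplus_ge0 sK))// ltW.
have Kb : K b = 1.
  apply/eqP; rewrite eq_le CDF_le1/= leNgt; apply/negP => Kb.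
  by move: Zb; rewrite ltNge (ub_le_sup (has_ubound_lt1 sK)).
apply/eqP; rewrite eq_le probability_le1//=.
rewrite -[leLHS]/(1%:E) -[X in X%:E]Kb -LS_itvNyc.
have /= := measureU2 (LS K) (measurable_itv `]-oo, 0[) (measurable_itv `[0, b]).
rewrite (concentrated_Iio KM) add0e; apply: le_trans.
apply: le_measure; rewrite ?inE//; first exact: measurableU.
move=> x /=; rewrite !in_itv/= => xb.
by have [x0|x0] := ltP x 0; [left|right].
Qed.

End Support.

Section Concentration.
Context {R : realType} (K : CDF R) (b : R).
Hypothesis Kb : LS K `[0, b] = 1%E.

Lemma LS_setI_concentrated (A : set (measurableTypeR R)) : measurable A ->
  LS K (`[0, b] `&` A) = LS K A.
Proof.
move=> mA; have /= -> := measureDI (LS K) mA (measurable_itv `[0, b]).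
rewrite (_ : LS K (A `\` `[0, b]) = 0%E) ?add0e 1?setIC//.
apply/eqP; rewrite eq_le measure_ge0 andbT -(LS_setC_concentrated Kb).
apply: le_measure; rewrite ?inE//; first exact: measurableD.
exact: measurableC.
Qed.

Lemma Rintegral_concentrated (f : R -> R) :
  measurable_fun (setT : set (measurableTypeR R)) f ->
  (LS K).-integrable `[0, b] (EFin \o f) ->
  \int[LS K]_(z in setT) f z = \int[LS K]_(z in `[0, b]) f z.
Proof.
move=> mf intf; rewrite /Rintegral; congr fine.
have D : setT `\` ~` `[0, b] = `[0, b]%classic by rewrite setTD setCK.
have mC : measurable (~` `[0, b] : set (measurableTypeR R)) by exact: measurableC.
have mT : measurable (setT : set (measurableTypeR R)) by exact: measurableT.
have mEf := (measurable_EFinP _ _).2 mf.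
have intT : (LS K).-integrable setT (EFin \o f).
  have H := @negligible_integrable _ _ _ (LS K) _ _ _ mC mT mEf.
  by apply/(H (LS_setC_concentrated Kb)); rewrite D.
by have := negligible_integral mC mT intT (LS_setC_concentrated Kb); rewrite D.
Qed.

(** The Riemann-Stieltjes sum of [f] along a partition: the error made on a cell
    is at most [e] times the mass of that cell, and the masses telescope. *)
Lemma step_sum_approx (f : R -> R) (x c : nat -> R) (e : R) :
  (LS K).-integrable `[0, b] (EFin \o f) ->
  (forall i, x i <= x i.+1) ->
  (forall i z, z \in `[0, b] -> x i < z <= x i.+1 -> `|f z - c i| <= e) ->
  forall m, `|\int[LS K]_(z in `[0, b] `&` `]x 0%N, x m]) f z -
              \sum_(i < m) c i * (K (x i.+1) - K (x i))|
            <= e * (K (x m) - K (x 0%N)).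
Proof.
move=> intf ndx fc; elim=> [|m IH].
  by rewrite set_itvoc0 setI0 Rintegral_set0 big_ord0 !subrr mulr0 normr0.
have x0m : x 0%N <= x m by elim: {IH}m => // m /le_trans; exact.
have mI (i j : R) : measurable (`[0, b] `&` `]i, j] : set (measurableTypeR R)).
  exact: measurableI.
have intI (i j : R) : (LS K).-integrable (`[0, b] `&` `]i, j]) (EFin \o f).
  by apply: integrableS intf => //; exact: subIsetl.
have -> : `[0, b] `&` `]x 0%N, x m.+1] =
  (`[0, b] `&` `]x 0%N, x m]) `|` (`[0, b] `&` `]x m, x m.+1]).
  rewrite -setIUr; congr (_ `&` _).
  by rewrite -itv_bndbnd_setU// bnd_simp.
rewrite Rintegral_setU//; first last.
- rewrite disj_set2E; apply/eqP; rewrite -subset0 => z /= [[_ +] [_ +]].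
  by rewrite !in_itv/= => /andP[_ /le_lt_trans zx] /andP[/zx]; rewrite ltxx.
- rewrite -setIUr; apply: integrableS intf => //.
  by apply: measurableI => //; exact: measurableU.
rewrite big_ord_recr/=.
set I0 := \int[_]_(_ in _) _ in IH *; set I1 := \int[_]_(_ in _) _.
set S := \sum_(_ < _) _ in IH *.
have H1 : `|I1 - c m * (K (x m.+1) - K (x m))| <= e * (K (x m.+1) - K (x m)).
  have Kcell : fine (LS K (`[0, b] `&` `]x m, x m.+1])) = K (x m.+1) - K (x m).
    by rewrite LS_setI_concentrated// LS_itvoc.
  have cstE r : \int[LS K]_(z in `[0, b] `&` `]x m, x m.+1]) r =
      r * (K (x m.+1) - K (x m)).
    by rewrite Rintegral_cst// Kcell.
  have intc (r : R) : (LS K).-integrable (`[0, b] `&` `]x m, x m.+1]) (EFin \o cst r).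
    exact: finite_measure_integrable_cst.
  have intB : (LS K).-integrable (`[0, b] `&` `]x m, x m.+1])
      (EFin \o (fun z => f z - c m)).
    exact: (integrableB (mI _ _) (intI _ _) (intc (c m))).
  rewrite -!cstE -(RintegralB (mI _ _) (intI _ _) (intc (c m))).
  apply: (le_trans (le_normr_Rintegral (mI _ _) intB)).
  apply: (le_Rintegral (mI _ _) (integrable_norm intB) (intc e)).
  by move=> z [zb zx]; apply: fc => //; move: zx; rewrite /= in_itv.
rewrite (_ : I0 + I1 - _ = (I0 - S) + (I1 - c m * (K (x m.+1) - K (x m)))); last by ring.
apply: le_trans (ler_normD _ _) _.
apply: le_trans (lerD IH H1) _.
by rewrite -mulrDr le_eqVlt; apply/orP; left; apply/eqP; ring.
Qed.

End Concentration.

(** * The Helly-Bray theorem for Lipschitz integrands *)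

Section HellyBray.
Context {R : realType}.
Implicit Types (K : CDF R) (b L : R) (f : R -> R).

Lemma lipschitz_integrable K b L f :
  measurable_fun (`[0, b] : set (measurableTypeR R)) f ->
  {in `[0, b] &, forall u v, `|f u - f v| <= L * `|u - v|} ->
  (LS K).-integrable `[0, b] (EFin \o f).
Proof.
move=> mf lipf; apply: measurable_bounded_integrable => //.
  by apply: le_lt_trans (ltry 1); exact: probability_le1.
exists (`|f 0| + `|L| * `|b|); split; first exact: num_real.
move=> M /ltW ltM z zb; apply: le_trans ltM.
have b0 : 0 <= b by move: zb; rewrite /= in_itv/= => /andP[/le_trans]; exact.
have h0 : 0 \in `[0, b] by rewrite in_itv/= lexx.
rewrite -lerBlDl; apply: le_trans (lerB_dist _ _) _.
apply: le_trans (lipf _ _ _ h0) _ => //.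
rewrite subr0; apply: le_trans (ler_wpM2r _ (ler_norm L)) _ => //.
move: zb; rewrite /= in_itv/= => /andP[z0 zb].
by rewrite ler_wpM2l// !ger0_norm.
Qed.

(** Along a fine partition by continuity points of [K], the Riemann-Stieltjes
    sums approximate the integrals uniformly over all measures carried by
    [0, b], while for each fixed partition the sums converge by weak
    convergence. *)
Lemma helly_bray_lipschitz (Kn : nat -> CDF R) K b L f :
  cdf_weak_cvg Kn K ->
  (\forall n \near \oo, LS (Kn n) `[0, b] = 1%E) -> LS K `[0, b] = 1%E ->
  measurable_fun (`[0, b] : set (measurableTypeR R)) f ->
  {in `[0, b] &, forall u v, `|f u - f v| <= L * `|u - v|} ->
  \int[LS (Kn n)]_(z in `[0, b]) f z @[n --> \oo] -->
  \int[LS K]_(z in `[0, b]) f z.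
Proof.
move=> wK bKn bK mf lipf; apply/cvgrPdist_le => e e0.
(* The cells below are shorter than [2 * d], so that [f] oscillates by at most
   [e / 3] on each; the [+ 1] keeps [d] defined when [L = 0]. *)
pose d : R := e / 3 / (2 * `|L| + 1).
have L1 : 0 < 2 * `|L| + 1 by rewrite ltr_wpDl// mulr_ge0.
have d0 : 0 < d by rewrite !divr_gt0.
have Ld : `|L| * (2 * d) <= e / 3.
  have -> : e / 3 = d * (2 * `|L| + 1) by rewrite /d; field; rewrite gt_eqF.
  by rewrite -subr_ge0 (_ : _ - _ = d) ?ltW//; ring.
(* One continuity point in each interval of length [d]; the first one is
   negative and [x m] exceeds [b], so the cells cover [0, b]. *)
have [x xP] : {x : nat -> R & forall i,
    i%:R * d - d < x i < i%:R * d /\ {for x i, continuous K}}.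
  apply: (@choice _ _ (fun i y =>
    i%:R * d - d < y < i%:R * d /\ {for y, continuous K})) => i.
  have [|y yi yK] := @dense_continuity_points R K (i%:R * d - d) (i%:R * d).
    by rewrite gtrBl.
  by exists y.
have x_lt i : i%:R * d - d < x i by have [/andP[]] := xP i.
have lt_x i : x i < i%:R * d by have [/andP[]] := xP i.
have xS i : x i <= x i.+1.
  by rewrite (le_trans (ltW (lt_x i)))// (le_trans _ (ltW (x_lt _)))// -natr1; lra.
have x00 : x 0%N < 0 by rewrite (lt_le_trans (lt_x _))// mul0r.
pose m := (Num.truncn (b / d)).+2.
have bxm : b <= x m.
  apply: le_trans (ltW (x_lt _)); rewrite /m -natr1 mulrDl mul1r addrK.
  by rewrite -ler_pdivrMr// ltW// truncnS_gt.
(* [x 0] lies outside [0, b], where [f] is not controlled. *)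
pose c i := f (Num.max 0 (x i)).
pose S (J : CDF R) := \sum_(i < m) c i * (J (x i.+1) - J (x i)).
have approx (J : CDF R) : LS J `[0, b] = 1%E ->
    `|\int[LS J]_(z in `[0, b]) f z - S J| <= e / 3.
  move=> bJ.
  have b0 : 0 <= b := concentrated_ge0 bJ.
  have intf := lipschitz_integrable J mf lipf.
  have cell i z : z \in `[0, b] -> x i < z <= x i.+1 -> `|f z - c i| <= e / 3.
    move=> zb /andP[xz zx]; apply: le_trans Ld.
    move: (zb); rewrite in_itv/= => /andP[z0 zb'].
    have maxb : Num.max 0 (x i) \in `[0, b].
      by rewrite in_itv/= le_max lexx/= ge_max b0/= (le_trans (ltW xz)).
    apply: le_trans (lipf _ _ zb maxb) _.
    apply: le_trans (ler_wpM2r _ (ler_norm L)) _ => //; apply: ler_wpM2l => //.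
    have := x_lt i; have := lt_x i.+1; rewrite -natr1 mulrDl mul1r => xi1 xi.
    by rewrite ler_norml; have [x0|x0] := leP 0 (x i); lra.
  have := step_sum_approx bJ intf xS cell m.
  rewrite (concentrated_lt0 bJ x00).
  have -> : J (x m) = 1.
    have := CDF_nondecreasing J bxm; rewrite (concentrated_edge bJ) => Jx.
    by apply/eqP; rewrite eq_le CDF_le1.
  rewrite subr0 mulr1 setIidl// => z /=; rewrite !in_itv/= => /andP[z0 zb].
  by rewrite (lt_le_trans x00 z0) (le_trans zb).
have SnS : S (Kn n) @[n --> \oo] --> S K.
  rewrite /S; apply: cvg_big => [|i _]; first exact: add_continuous.
  apply: cvgM; first exact: cvg_cst.
  by apply: cvgB; apply: wK; have [] := xP i; have [] := xP i.+1.
have e3 : 0 < e / 3 by rewrite divr_gt0.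
near=> n.
have -> : \int[LS K]_(z in `[0, b]) f z - \int[LS (Kn n)]_(z in `[0, b]) f z =
  (\int[LS K]_(z in `[0, b]) f z - S K) + (S K - S (Kn n)) +
  (S (Kn n) - \int[LS (Kn n)]_(z in `[0, b]) f z) by ring.
have -> : e = e / 3 + e / 3 + e / 3 by field.
apply: le_trans (ler_normD _ _) _; apply: lerD.
  apply: le_trans (ler_normD _ _) _; apply: lerD; first exact: approx.
  near: n; by move/cvgrPdist_le : SnS; apply.
rewrite distrC; apply: approx.
by near: n.
Unshelve. all: end_near. Qed.
End HellyBray.

(** * The resolvent kernel and its moments *)

Section Resolvent.
Context {R : realType}.
Implicit Types (K : CDF R) (b y z : R) (j : nat).

Definition resolvent y z : R := (y ^+ 2 - z ^+ 2)^-1.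

Lemma resolvent_den_gt0 b y z : z \in `[0, b] -> b < y -> 0 < y ^+ 2 - z ^+ 2.
Proof.
rewrite in_itv/= => /andP[z0 zb] yb; have zy := le_lt_trans zb yb.
by rewrite subr_gt0 ltr_pXn2r// nnegrE// (le_trans z0)// ltW.
Qed.

Lemma measurable_invr : measurable_fun (setT : set (measurableTypeR R)) (@GRing.inv R).
Proof.
have -> : setT = [set 0] `|` ~` [set 0] :> set (measurableTypeR R) by rewrite setUv.
apply/measurable_funU; [by []|exact: measurableC|split].
  exact: measurable_fun_set1.
apply: subspace_continuous_measurable_fun; first exact: measurableC.
apply: continuous_in_subspaceT => x; rewrite inE/= => /eqP x0.
exact: inv_continuous.
Qed.

Lemma measurable_resolvent_expn y j :
  measurable_fun (setT : set (measurableTypeR R)) (fun z => resolvent y z ^+ j).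
Proof.
apply: measurable_funX; apply: (measurableT_comp measurable_invr).
by apply: measurable_funB => //; exact: measurable_funX.
Qed.

Lemma resolvent_gt0 b y z : z \in `[0, b] -> b < y -> 0 < resolvent y z.
Proof. by move=> zb yb; rewrite invr_gt0 (resolvent_den_gt0 zb yb). Qed.

Lemma resolvent_le b y z : z \in `[0, b] -> b < y ->
  resolvent y z <= resolvent y b.
Proof.
move=> zb yb; have := zb; rewrite in_itv/= => /andP[z0 zb'].
have bb : b \in `[0, b] by rewrite in_itv/= lexx (le_trans z0).
rewrite lef_pV2 ?posrE ?(resolvent_den_gt0 zb yb) ?(resolvent_den_gt0 bb yb)//.
by rewrite lerB// ler_pXn2r// nnegrE (le_trans z0).
Qed.

(** By induction on [j]; the base step is the resolvent identity
    [R(y,u) - R(y,v) = (u^2 - v^2) R(y,u) R(y,v)], and [R(y,.)] is bounded by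
    its value at [b]. *)
Lemma resolvent_expn_lipschitz b y j : b < y ->
  exists L, {in `[0, b] &, forall u v,
    `|resolvent y u ^+ j - resolvent y v ^+ j| <= L * `|u - v|}.
Proof.
move=> yb; set B := resolvent y b.
have hB u : u \in `[0, b] -> `|resolvent y u| <= B.
  by move=> ub; rewrite gtr0_norm ?(resolvent_gt0 ub yb)// resolvent_le.
have lip1 : {in `[0, b] &, forall u v,
    `|resolvent y u - resolvent y v| <= (2 * b * B ^+ 2) * `|u - v|}.
  move=> u v ub vb.
  have -> : resolvent y u - resolvent y v =
      (u + v) * (resolvent y u * resolvent y v) * (u - v).
    rewrite /resolvent; field.
    by rewrite !gt_eqF// ?(resolvent_den_gt0 ub yb) ?(resolvent_den_gt0 vb yb).
  have B0 : 0 <= B by apply: le_trans (hB _ ub).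
  rewrite normrM ler_wpM2r// normrM; apply: ler_pM => //.
    move: ub vb; rewrite !in_itv/= => /andP[u0 ub] /andP[v0 vb].
    by rewrite ger0_norm ?addr_ge0//; lra.
  by rewrite normrM expr2 ler_pM// hB.
elim: j => [|j [L IH]].
  by exists 0 => u v _ _; rewrite !expr0 subrr normr0 mul0r.
exists (B * L + (2 * b * B ^+ 2) * B ^+ j) => u v ub vb.
have -> : resolvent y u ^+ j.+1 - resolvent y v ^+ j.+1 =
    resolvent y u * (resolvent y u ^+ j - resolvent y v ^+ j) +
    (resolvent y u - resolvent y v) * resolvent y v ^+ j.
  by rewrite !exprS; ring.
apply: le_trans (ler_normD _ _) _; rewrite [leRHS]mulrDl; apply: lerD.
  rewrite normrM -mulrA; apply: ler_pM => //; first exact: hB.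
  exact: IH.
rewrite normrM mulrAC; apply: ler_pM => //; first exact: lip1.
by rewrite normrX; apply: lerXn2r; rewrite ?nnegrE ?hB// (le_trans _ (hB _ ub)).
Qed.

Lemma integrable_resolvent K b y j : b < y ->
  (LS K).-integrable `[0, b] (fun z => (resolvent y z ^+ j)%:E).
Proof.
move=> yb; have [L lipL] := resolvent_expn_lipschitz j yb.
apply: (lipschitz_integrable _ _ lipL).
by apply: measurable_funTS; exact: measurable_resolvent_expn.
Qed.

(** The integral is over the whole line, like the one that defines [phi]. There
    the kernel has poles at [z = y] and [z = -y], where it takes the value 0;
    [resolvent_momentE] restricts the integral to the support. *)
Definition resolvent_moment K j y : R :=
  \int[LS K]_(z in setT) (resolvent y z ^+ j).

Lemma resolvent_momentE K b y j : LS K `[0, b] = 1%E -> b < y ->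
  resolvent_moment K j y = \int[LS K]_(z in `[0, b]) (resolvent y z ^+ j).
Proof.
move=> Kb yb; apply: (Rintegral_concentrated Kb); last exact: integrable_resolvent.
exact: measurable_resolvent_expn.
Qed.

Lemma cvg_resolvent_moment (Kn : nat -> CDF R) K b y j :
  cdf_weak_cvg Kn K ->
  (\forall n \near \oo, LS (Kn n) `[0, b] = 1%E) -> LS K `[0, b] = 1%E -> b < y ->
  resolvent_moment (Kn n) j y @[n --> \oo] --> resolvent_moment K j y.
Proof.
move=> wK bKn bK yb; have [L lipL] := resolvent_expn_lipschitz j yb.
rewrite (resolvent_momentE j bK yb).
have mf : measurable_fun (`[0, b] : set (measurableTypeR R))
    (fun z => resolvent y z ^+ j).
  by apply: measurable_funTS; exact: measurable_resolvent_expn.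
apply: cvg_trans (helly_bray_lipschitz wK bKn bK mf lipL).
by apply: near_eq_cvg; near=> n; rewrite (@resolvent_momentE _ b)//; near: n.
Unshelve. all: end_near. Qed.

End Resolvent.

(** * Inequalities between moments *)

Section Moments.
Context {R : realType} (K : CDF R) (b : R).
Hypothesis Kb : LS K `[0, b] = 1%E.
Implicit Types (c y z : R).

Local Notation m := (resolvent_moment K).

Lemma resolvent_moment0 y : b < y -> m 0 y = 1.
Proof.
move=> yb; rewrite (resolvent_momentE _ Kb yb).
under eq_Rintegral do rewrite expr0.
have K1 : fine (LS K `[0, b]) = 1 by rewrite Kb.
by rewrite Rintegral_cst// K1 mul1r.
Qed.

(** Every moment inequality below is obtained by integrating a pointwise
    inequality between finitely many powers of resolvents. An item
    [(a, (j, y))] of [s] stands for the term [a * R(y,z)^j]. *)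
Lemma resolvent_moments_ge0 (s : seq (R * (nat * R))) :
  all (fun t => b < t.2.2) s ->
  (forall z, z \in `[0, b] -> 0 <= \sum_(t <- s) t.1 * resolvent t.2.2 z ^+ t.2.1) ->
  0 <= \sum_(t <- s) t.1 * m t.2.1 t.2.2.
Proof.
move=> sb s0.
suff -> : \sum_(t <- s) t.1 * m t.2.1 t.2.2 =
    \int[LS K]_(z in `[0, b]) \sum_(t <- s) t.1 * resolvent t.2.2 z ^+ t.2.1.
  by apply: Rintegral_ge0 => z zb; exact: s0.
suff [] : \sum_(t <- s) t.1 * m t.2.1 t.2.2 =
    \int[LS K]_(z in `[0, b]) (\sum_(t <- s) t.1 * resolvent t.2.2 z ^+ t.2.1)
  /\ (LS K).-integrable `[0, b]
    (fun z => (\sum_(t <- s) t.1 * resolvent t.2.2 z ^+ t.2.1)%:E) by [].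
elim: s sb {s0} => [_|[a [j y]] s IH /= /andP[yb /IH[sE sint]]].
  under eq_Rintegral do rewrite big_nil.
  rewrite Rintegral_cst// mul0r big_nil; split=> //.
  rewrite (_ : (fun z => _) = EFin \o cst 0); last first.
    by apply/funext => z /=; rewrite big_nil.
  exact: (finite_measure_integrable_cst (LS K) 0).
under eq_Rintegral do rewrite big_cons.
rewrite big_cons/= sE (resolvent_momentE _ Kb yb).
have intj : (LS K).-integrable `[0, b] (fun z => (a * resolvent y z ^+ j)%:E).
  have h := integrableZl _ a (integrable_resolvent K j yb).
  exact: h.
rewrite RintegralD// RintegralZl//; last exact: integrable_resolvent.
split => //.
rewrite (_ : (fun z => _) = (fun z => (a * resolvent y z ^+ j)%:E +
    (\sum_(t <- s) t.1 * resolvent t.2.2 z ^+ t.2.1)%:E)%E); last first.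
  by apply/funext => z /=; rewrite big_cons.
have h := integrableD _ intj sint.
exact: h.
Qed.

Lemma sqr_resolvent_ge1 y z : z \in `[0, b] -> b < y -> 1 <= y ^+ 2 * resolvent y z.
Proof.
move=> zb yb; rewrite ler_pdivlMr ?(resolvent_den_gt0 zb yb)// mul1r.
by rewrite gerBl sqr_ge0.
Qed.

Lemma concentrated_lt_gt0 y : b < y -> 0 < y.
Proof. exact: (le_lt_trans (concentrated_ge0 Kb)). Qed.

Lemma sqr_moment1_ge1 y : b < y -> 1 <= y ^+ 2 * m 1 y.
Proof.
move=> yb; have := @resolvent_moments_ge0 [:: (y ^+ 2, (1%N, y)); (-1, (0%N, y))].
rewrite /= yb => /(_ isT); rewrite !big_cons big_nil/= resolvent_moment0// => H.
rewrite -subr_ge0; have -> : y ^+ 2 * m 1 y - 1 = y ^+ 2 * m 1 y + (-1 * 1 + 0) by ring.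
apply: H => z zb; rewrite !big_cons big_nil/= expr1 expr0.
by have := sqr_resolvent_ge1 zb yb; lra.
Qed.

Lemma moment1_gt0 y : b < y -> 0 < m 1 y.
Proof.
move=> yb; have y0 := concentrated_lt_gt0 yb.
have := sqr_moment1_ge1 yb; have y2 : 0 < y ^+ 2 by rewrite exprn_gt0.
by move=> h; rewrite -(pmulr_rgt0 _ y2); lra.
Qed.

Lemma moment1_le_sqr_moment2 y : b < y -> m 1 y <= y ^+ 2 * m 2 y.
Proof.
move=> yb; have := @resolvent_moments_ge0 [:: (y ^+ 2, (2%N, y)); (-1, (1%N, y))].
rewrite /= yb => /(_ isT); rewrite !big_cons big_nil/= => H.
rewrite -subr_ge0; have -> : y ^+ 2 * m 2 y - m 1 y =
  y ^+ 2 * m 2 y + (-1 * m 1 y + 0) by ring.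
apply: H => z zb; rewrite !big_cons big_nil/= expr1.
have h1 := sqr_resolvent_ge1 zb yb; have h0 := resolvent_gt0 zb yb.
rewrite (_ : _ + _ = (y ^+ 2 * resolvent y z - 1) * resolvent y z); last by ring.
by rewrite mulr_ge0 ?subr_ge0// ltW.
Qed.

Lemma sqr_moment1_nonincreasing y1 y2 : b < y1 -> y1 < y2 ->
  y2 ^+ 2 * m 1 y2 <= y1 ^+ 2 * m 1 y1.
Proof.
move=> yb1 y12; have yb2 := lt_trans yb1 y12.
have y10 := concentrated_lt_gt0 yb1.
have := @resolvent_moments_ge0 [:: (y1 ^+ 2, (1%N, y1)); (- y2 ^+ 2, (1%N, y2))].
rewrite /= yb1 yb2 => /(_ isT); rewrite !big_cons big_nil/= => H.
rewrite -subr_ge0; have -> : y1 ^+ 2 * m 1 y1 - y2 ^+ 2 * m 1 y2 =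
  y1 ^+ 2 * m 1 y1 + (- y2 ^+ 2 * m 1 y2 + 0) by ring.
apply: H => z zb; rewrite !big_cons big_nil/= !expr1.
have d1 := resolvent_den_gt0 zb yb1; have d2 := resolvent_den_gt0 zb yb2.
rewrite (_ : _ + _ = z ^+ 2 * (y2 ^+ 2 - y1 ^+ 2) *
    (resolvent y1 z * resolvent y2 z)); last first.
  by rewrite /resolvent; field; rewrite !gt_eqF.
apply: mulr_ge0; last by rewrite mulr_ge0// invr_ge0 ltW.
apply: mulr_ge0; first exact: sqr_ge0.
by rewrite subr_ge0 ler_pXn2r ?nnegrE ?ltW// (lt_trans y10).
Qed.

(** With [A = y1^2 < B = y2^2], [h1 = R(y1,z)] and [h2 = R(y2,z)], one has
    [h1 = h2 / (1 - (B - A) h2)], a ratio to [h2] that increases with [h2]. Let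
    [x = m_2(y2) / m_1(y2)], the mean of [h2] under the density proportional to
    [h2]. Comparing that ratio with its value [rho] at [h2 = x] gives
    [(h2 - x) h1 >= rho (h2 - x) h2], and the integral of the right-hand side
    vanishes by the choice of [x]. Together with
    [A^2 h1 - A >= B^2 h2 - B], which says that [A z^2 / (A - z^2)] decreases in
    [A], this is the claim. *)
Lemma moment_ratio_nonincreasing y1 y2 : b < y1 -> y1 < y2 ->
  y2 ^+ 2 * (y2 ^+ 2 * m 2 y2 / m 1 y2 - 1) <= y1 ^+ 2 * (y1 ^+ 2 * m 2 y1 / m 1 y1 - 1).
Proof.
move=> yb1 y12; have yb2 := lt_trans yb1 y12.
have y10 := concentrated_lt_gt0 yb1.
have b0 := concentrated_ge0 Kb.
have bb : b \in `[0, b] by rewrite in_itv/= lexx b0.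
have m10 := moment1_gt0 yb1; have m20 := moment1_gt0 yb2.
set A := y1 ^+ 2; set B := y2 ^+ 2; set x := m 2 y2 / m 1 y2.
have AB : 0 < B - A by rewrite subr_gt0 ltr_pXn2r ?nnegrE ?ltW// (lt_trans y10).
(* [x] is a mean of values [h2 <= R(y2,b)], and [B - A < B - b^2]. *)
have x_lt : (B - A) * x < 1.
  have x_le : x <= resolvent y2 b.
    rewrite ler_pdivrMr//.
    have := @resolvent_moments_ge0 [:: (resolvent y2 b, (1%N, y2)); (- 1, (2%N, y2))].
    rewrite /= yb2 => /(_ isT); rewrite !big_cons big_nil/= => H.
    rewrite -subr_ge0.
    have -> : resolvent y2 b * m 1 y2 - m 2 y2 =
      resolvent y2 b * m 1 y2 + (-1 * m 2 y2 + 0) by ring.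
    apply: H => z zb; rewrite !big_cons big_nil/= expr1.
    rewrite (_ : _ + _ = (resolvent y2 b - resolvent y2 z) * resolvent y2 z).
      by rewrite mulr_ge0 ?subr_ge0 ?resolvent_le// ltW// (resolvent_gt0 zb yb2).
    by ring.
  apply: le_lt_trans (ler_wpM2l (ltW AB) x_le) _.
  rewrite ltr_pdivrMr ?(resolvent_den_gt0 bb yb2)// mul1r -/B.
  by have := resolvent_den_gt0 bb yb1; rewrite -/A; lra.
pose rho := (1 - (B - A) * x)^-1.
have rho0 : 0 <= rho by rewrite invr_ge0 subr_ge0 ltW.
(* The sum of the two pointwise inequalities; the terms in [m 2 y2] and
   [m 1 y2] cancel after integration. *)
have := @resolvent_moments_ge0 [:: (A ^+ 2, (2%N, y1)); (B - A - B ^+ 2 * x, (1%N, y1));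
  (- (B ^+ 2 * rho), (2%N, y2)); (B ^+ 2 * rho * x, (1%N, y2))].
rewrite /= yb1 yb2 => /(_ isT); rewrite !big_cons big_nil/= addr0.
have -> : - (B ^+ 2 * rho) * m 2 y2 + B ^+ 2 * rho * x * m 1 y2 = 0.
  by rewrite /x; field; rewrite gt_eqF.
rewrite addr0 => H.
suff goal : B * (B * x - 1) <= A * (A * (m 2 y1 / m 1 y1) - 1).
  by rewrite -[B * m 2 y2 / _]mulrA -[A * m 2 y1 / _]mulrA.
rewrite -subr_ge0 -(pmulr_lge0 _ m10).
rewrite [leRHS](_ : _ = A ^+ 2 * m 2 y1 + (B - A - B ^+ 2 * x) * m 1 y1); last first.
  by field; rewrite gt_eqF.
apply: H => z zb; rewrite !big_cons big_nil/= !expr1.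
have d1 := resolvent_den_gt0 zb yb1; have d2 := resolvent_den_gt0 zb yb2.
have h1 := resolvent_gt0 zb yb1; have h2 := resolvent_gt0 zb yb2.
(* A sum of squares with nonnegative weights: the first one comes from the
   monotonicity in [A], the second from the comparison at [x]. *)
rewrite [leRHS](_ : _ = (B - A) * resolvent y1 z *
   (z ^+ 2 ^+ 2 * (resolvent y1 z * resolvent y2 z) +
    B ^+ 2 * rho * (resolvent y2 z - x) ^+ 2)).
  apply: mulr_ge0; first by rewrite mulr_ge0// ltW.
  apply: addr_ge0; apply: mulr_ge0; rewrite ?sqr_ge0//.
    by rewrite ltW// mulr_gt0.
  by apply: mulr_ge0; rewrite ?sqr_ge0.
rewrite /resolvent /rho -/A -/B; rewrite -/A in d1; rewrite -/B in d2.
by field; rewrite !gt_eqF// subr_gt0.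
Qed.

End Moments.

(** * Differentiation under the integral sign *)

Section Derivative.
Context {R : realType}.
Implicit Types (K : CDF R) (b c y z : R).

Lemma is_derive_resolvent y z : y ^+ 2 - z ^+ 2 != 0 ->
  is_derive y 1 (fun x => resolvent x z) (- (2 * y) * resolvent y z ^+ 2).
Proof.
move=> d0.
have dden : is_derive y 1 (fun x : R => x ^+ 2 - z ^+ 2) (2 * y).
  have H := is_deriveB (is_deriveX 2 (is_derive_id y 1)) (is_derive_cst (z ^+ 2) y 1).
  apply: (@is_derive_eq _ _ _ _ _ _ _ _ H).
  by rewrite subr0 /= expr1 scaler1.
have H := @is_deriveV _ _ y _ 1 d0 dden.
apply: (@is_derive_eq _ _ _ _ _ _ _ _ H).
by rewrite /resolvent /GRing.scale/= exprVn; ring.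
Qed.

(** Near [y] the points [x] stay above [u], halfway between [b] and [y], so the
    derivative of the kernel is dominated on [0, b] by a constant. *)
Lemma is_derive_resolvent_moment1 K b y : LS K `[0, b] = 1%E -> b < y ->
  is_derive y 1 (resolvent_moment K 1) (- (2 * y) * resolvent_moment K 2 y).
Proof.
move=> Kb yb.
have b0 := concentrated_ge0 Kb.
have y0 := concentrated_lt_gt0 Kb yb.
pose u := (b + y) / 2.
have bu : b < u by rewrite /u; lra.
have uy : u < y by rewrite /u; lra.
have bb : b \in `[0, b] by rewrite in_itv/= lexx b0.
have hu := resolvent_gt0 bb bu.
pose F x := \int[LS K]_(z in `[0, b]) resolvent x z.
have ub x : x \in `]u, (y + 1)[ -> b < x.
  by rewrite in_itv/= => /andP[/(lt_trans bu)].
have Iy : y \in `]u, (y + 1)[ by rewrite in_itv/= uy ltrDl ltr01.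
have intF x : x \in `]u, (y + 1)[ ->
    (LS K).-integrable `[0, b] (EFin \o resolvent x).
  by move=> /ub bx; have h := integrable_resolvent K 1 bx; exact: h.
have dres x z : x \in `]u, (y + 1)[ -> z \in `[0, b] ->
    is_derive x 1 (fun x => resolvent x z) (- (2 * x) * resolvent x z ^+ 2).
  by move=> /ub bx zb; apply: is_derive_resolvent; rewrite gt_eqF// (resolvent_den_gt0 zb).
pose G : R := 2 * (y + 1) * resolvent u b ^+ 2.
have derf x z : x \in `]u, (y + 1)[ -> z \in `[0, b] -> derivable (resolvent^~ z) x 1.
  by move=> xI zb; have [] := dres _ _ xI zb.
have G0 z : 0 <= cst G z by rewrite /G/=; nra.
have intG : (LS K).-integrable `[0, b] (EFin \o cst G).
  exact: finite_measure_integrable_cst.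
have Gub x z : x \in `]u, (y + 1)[ -> z \in `[0, b] ->
    `|partial1of2 resolvent x z| <= cst G z.
  move=> xI zb; rewrite partial1of2E; have [_ ->] := dres _ _ xI zb.
  have hx := resolvent_gt0 zb (ub _ xI).
  have hxu : resolvent x z <= resolvent u b.
    apply: le_trans (resolvent_le zb (ub _ xI)) _.
    rewrite lef_pV2 ?posrE ?(resolvent_den_gt0 bb)// ?ub//.
    move: xI; rewrite in_itv/= => /andP[ux _]; have u0 := le_lt_trans b0 bu.
    by rewrite lerD2r ler_pXn2r ?nnegrE ?ltW// (lt_trans u0).
  move: (xI); rewrite in_itv/= => /andP[ux xy].
  rewrite mulNr normrN ger0_norm; last by rewrite mulr_ge0 ?sqr_ge0//; lra.
  apply: ler_pM; rewrite ?sqr_ge0//; [lra|lra|].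
  by rewrite ler_pXn2r// nnegrE ltW.
have mD : measurable (`[0, b] : set (measurableTypeR R)) by exact: measurable_itv.
have dF := @derivable_under_integral R _ _ (LS K) resolvent _ mD y u (y + 1)
  Iy intF derf _ G0 intG Gub.
have FE := @differentiation_under_integral R _ _ (LS K) resolvent _ mD y u (y + 1)
  Iy intF derf _ G0 intG Gub.
have nearE : \near y, F y = resolvent_moment K 1 y.
  near=> x; rewrite (resolvent_momentE _ Kb); last by near: x; exact: lt_nbhsr.
  by apply: eq_Rintegral => z _; rewrite expr1.
have <- : derive1 F y = - (2 * y) * resolvent_moment K 2 y.
  rewrite FE (resolvent_momentE _ Kb yb) -RintegralZl//; last exact: integrable_resolvent.
  apply: eq_Rintegral => z; rewrite inE => zb.
  by rewrite partial1of2E; have [_ ->] := dres _ _ Iy zb.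
rewrite derive1E (near_eq_derive _ nearE).
apply: derivableP; apply: near_eq_derivable dF.
exact: nearE.
Unshelve. all: end_near. Qed.

End Derivative.

(** * The logarithmic derivative of the D-transform *)

Section Psi.
Context {R : realType}.
Implicit Types (K : CDF R) (b c y z : R).

(** In terms of the means [E] of powers of [g = y^2 / (y^2 - z^2)], this is
    [E g^2 / E g - 1] for [H], plus the same quantity for the mixture of [H]
    with weight [c] and of the unit mass at 0 with weight [1 - c]. *)
Definition edge_excess c K y : R :=
  let G := y ^+ 2 * resolvent_moment K 1 y in
  (y ^+ 2 * resolvent_moment K 2 y / resolvent_moment K 1 y - 1) *
  (1 + c * G / (c * G + 1 - c)).

Lemma phiE K b y : LS K `[0, b] = 1%E -> b < y ->
  phi K y = y * resolvent_moment K 1 y.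
Proof.
move=> Kb yb; have int1 := integrable_resolvent K 1 yb.
have intm : (LS K).-integrable `[0, b] (fun z => (y * resolvent y z ^+ 1)%:E).
  by have h := integrableZl _ y int1; exact: h.
rewrite (resolvent_momentE _ Kb yb) -RintegralZl//.
rewrite -(Rintegral_concentrated Kb _ intm) //.
by apply: measurable_funM => //; exact: measurable_resolvent_expn.
Qed.

Lemma weight_gt0 c G : 0 <= c <= 1 -> 1 <= G -> 0 < c * G + 1 - c.
Proof. by move=> /andP[c0 c1] G1; nra. Qed.

Lemma PsiE c K b y : LS K `[0, b] = 1%E -> b < y -> 0 <= c <= 1 ->
  Psi c K y = - 2 * (1 + edge_excess c K y).
Proof.
move=> Kb yb c01.
have y0 := concentrated_lt_gt0 Kb yb.
pose m1 := resolvent_moment K 1; pose m2 := resolvent_moment K 2.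
have m10 : 0 < m1 y := moment1_gt0 Kb yb.
have w0 := weight_gt0 c01 (sqr_moment1_ge1 Kb yb).
(* Expanding the product removes the quotient [(1 - c) / y]. *)
pose D x := c * (x ^+ 2 * m1 x ^+ 2) + (1 - c) * m1 x.
have DE x : b < x -> Dtransform c K x = D x.
  move=> bx; rewrite /Dtransform /phi_tilde (phiE Kb bx) -/(m1 x) /D.
  by field; rewrite gt_eqF// (concentrated_lt_gt0 Kb bx).
have dm1 : is_derive y 1 m1 (- (2 * y) * m2 y) := is_derive_resolvent_moment1 Kb yb.
have dD := is_deriveD
  (is_deriveM (is_derive_cst c y 1)
     (is_deriveM (is_deriveX 2 (is_derive_id y 1)) (is_deriveX 2 dm1)))
  (is_deriveM (is_derive_cst (1 - c) y 1) dm1).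
have nearD : \near y, D y = Dtransform c K y.
  by near=> x; rewrite DE//; near: x; exact: lt_nbhsr.
rewrite /Psi DE// derive1E -(near_eq_derive _ nearD).
have -> : 'D_1 D y = 2 * c * y * m1 y ^+ 2 -
    2 * y * m2 y * (2 * c * y ^+ 2 * m1 y + (1 - c)).
  have [_ ->] := dD.
  rewrite /GRing.scale/= -[(id ^+ 2) y]/(y ^+ 2) -[(m1 ^+ 2) y]/(m1 y ^+ 2) !mulr0 /cst.
  by ring.
rewrite /edge_excess /D -/(m1 y) -/(m2 y).
field; rewrite !gt_eqF//=.
have -> : c * (y * m1 y) ^+ 2 + (1 - c) * m1 y = m1 y * (c * (y ^+ 2 * m1 y) + 1 - c).
  by ring.
by rewrite mulr_gt0.
Unshelve. all: end_near. Qed.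

(** Both factors of the excess are nonnegative and nonincreasing once [y^2] is
    attached to the first one. Keeping this [y^2] yields a quantitative decrease
    of the excess itself, including its decay at infinity. *)
Lemma edge_excess_sqr_nonincreasing c K b y1 y2 : LS K `[0, b] = 1%E ->
  0 <= c <= 1 -> b < y1 -> y1 < y2 ->
  y2 ^+ 2 * edge_excess c K y2 <= y1 ^+ 2 * edge_excess c K y1.
Proof.
move=> Kb c01 yb1 y12; have yb2 := lt_trans yb1 y12.
rewrite /edge_excess [leLHS]mulrA [leRHS]mulrA.
have G1 := sqr_moment1_ge1 Kb yb1; have G2 := sqr_moment1_ge1 Kb yb2.
have w1 := weight_gt0 c01 G1; have w2 := weight_gt0 c01 G2.
have G21 := sqr_moment1_nonincreasing Kb yb1 y12.
have Q := moment_ratio_nonincreasing Kb yb1 y12.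
have Q2 : 0 <= y2 ^+ 2 * resolvent_moment K 2 y2 / resolvent_moment K 1 y2 - 1.
  rewrite subr_ge0 ler_pdivlMr ?(moment1_gt0 Kb yb2)// mul1r.
  by rewrite (moment1_le_sqr_moment2 Kb).
have /andP[c0 c1] := c01.
apply: ler_pM => //.
- by apply: mulr_ge0 => //; exact: sqr_ge0.
- by rewrite addr_ge0// divr_ge0 ?(ltW w2)// mulr_ge0// (le_trans ler01).
rewrite lerD2l ler_pdivrMr// [leRHS]mulrAC ler_pdivlMr//.
set a := y1 ^+ 2 * _ in w1 G21 *; set a' := y2 ^+ 2 * _ in w2 G21 *.
rewrite -subr_ge0 [leRHS](_ : _ = c * (1 - c) * (a - a')); last by ring.
by rewrite !mulr_ge0// subr_ge0.
Qed.

End Psi.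

(** * The threshold *)

Section Threshold.
Context {R : realType}.
Implicit Types (K : CDF R) (c y : R).

Lemma concentrated_between K y : compactly_supported_nneg K -> Zplus K < y ->
  exists2 b, LS K `[0, b] = 1%E & b < y.
Proof.
move=> sK Zy; exists ((Zplus K + y) / 2); last by lra.
by apply: concentrated_gt_Zplus => //; lra.
Qed.

Definition threshold_set c K : set R :=
  [set y | Zplus K < y /\ - 4 <= Psi c K y].

Lemma threshold_setP c K y : compactly_supported_nneg K -> 0 <= c <= 1 ->
  threshold_set c K y <-> Zplus K < y /\ edge_excess c K y <= 1.
Proof.
move=> sK c01; split => -[Zy]; have [b Kb yb] := concentrated_between sK Zy;
  rewrite /threshold_set/= (PsiE Kb yb c01) => h; split => //; lra.
Qed.

(** [y2^2 W(y2) <= y1^2 W(y1) <= y1^2 < y2^2]; this includes the degenerate case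
    of the unit mass at 0, where the excess vanishes identically. *)
Lemma edge_excess_lt1 c K y1 y2 : compactly_supported_nneg K -> 0 <= c <= 1 ->
  threshold_set c K y1 -> y1 < y2 -> edge_excess c K y2 < 1.
Proof.
move=> sK c01 /threshold_setP[]// Zy1 W1 y12.
have [b Kb yb] := concentrated_between sK Zy1.
have y10 := concentrated_lt_gt0 Kb yb.
have := edge_excess_sqr_nonincreasing Kb c01 yb y12 => W12.
have y2_gt : y1 ^+ 2 < y2 ^+ 2 by rewrite ltr_pXn2r ?nnegrE ?ltW// (lt_trans y10).
have y1_gt : 0 < y1 ^+ 2 by rewrite exprn_gt0.
rewrite -(ltr_pM2l (lt_trans y1_gt y2_gt)) mulr1.
apply: le_lt_trans W12 (le_lt_trans _ y2_gt).
by rewrite -[leRHS]mulr1 ler_pM2l.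
Qed.

Lemma has_inf_threshold_set c K : compactly_supported_nneg K -> 0 <= c <= 1 ->
  has_inf (threshold_set c K).
Proof.
move=> sK c01; split; last by exists (Zplus K) => y [/ltW].
have Z0 := Zplus_ge0 sK.
pose y0 := Zplus K + 1; pose Q := edge_excess c K y0.
have Zy0 : Zplus K < y0 by rewrite ltrDl.
have y01 : 1 <= y0 by rewrite /y0; lra.
have Q0 : 0 <= `|Q| by [].
have yy : y0 < y0 * (2 + `|Q|) by nra.
have Zy := lt_trans Zy0 yy.
(* Since [y^2 W(y) <= y0^2 Q], any [y > y0] with
   [y^2 >= y0^2 Q] belongs to the set. *)
exists (y0 * (2 + `|Q|)); apply/threshold_setP => //; split=> //.
have [b Kb yb] := concentrated_between sK Zy0.
have := edge_excess_sqr_nonincreasing Kb c01 yb yy; rewrite -/Q => H.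
have y2_gt0 : 0 < (y0 * (2 + `|Q|)) ^+ 2 by rewrite exprn_gt0//; lra.
rewrite -(ler_pM2l y2_gt0) mulr1; apply: le_trans H _.
rewrite exprMn ler_wpM2l ?sqr_ge0//.
by have := ler_norm Q; nra.
Qed.

Lemma Zplus_le_Tthreshold c K : compactly_supported_nneg K -> 0 <= c <= 1 ->
  Zplus K <= Tthreshold c K.
Proof.
move=> sK c01; apply: lb_le_inf; first by have [] := has_inf_threshold_set sK c01.
by move=> y [/ltW].
Qed.

Lemma Tthreshold_le c K y : compactly_supported_nneg K -> 0 <= c <= 1 ->
  Zplus K < y -> edge_excess c K y <= 1 -> Tthreshold c K <= y.
Proof.
move=> sK c01 Zy Wy; apply: ge_inf; first by have [] := has_inf_threshold_set sK c01.
exact/threshold_setP.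
Qed.

Lemma le_Tthreshold c K y : compactly_supported_nneg K -> 0 <= c <= 1 ->
  1 < edge_excess c K y -> y <= Tthreshold c K.
Proof.
move=> sK c01 Wy.
apply: lb_le_inf; first by have [] := has_inf_threshold_set sK c01.
move=> x xS; rewrite leNgt; apply/negP => xy.
by move: (edge_excess_lt1 sK c01 xS xy); rewrite ltNge ltW.
Qed.

Lemma cvg_edge_excess (cn : nat -> R) c (Kn : nat -> CDF R) K y :
  cn n @[n --> \oo] --> c -> 0 <= c <= 1 ->
  compactly_supported_nneg K -> (forall n, compactly_supported_nneg (Kn n)) ->
  cdf_weak_cvg Kn K -> Zplus (Kn n) @[n --> \oo] --> Zplus K ->
  Zplus K < y ->
  edge_excess (cn n) (Kn n) y @[n --> \oo] --> edge_excess c K y.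
Proof.
move=> cc c01 sK sKn wK Zc Zy.
pose b := (Zplus K + y) / 2.
have Zb : Zplus K < b by rewrite /b; lra.
have yb : b < y by rewrite /b; lra.
have Kb := concentrated_gt_Zplus sK Zb.
have Knb : \forall n \near \oo, LS (Kn n) `[0, b] = 1%E.
  near=> n; apply: concentrated_gt_Zplus => //; near: n.
  exact: (cvgr_lt _ Zc).
have cm j : resolvent_moment (Kn n) j y @[n --> \oo] --> resolvent_moment K j y.
  exact: cvg_resolvent_moment wK Knb Kb yb.
have m1 := moment1_gt0 Kb yb.
have w := weight_gt0 c01 (sqr_moment1_ge1 Kb yb).
have cG : cn n * (y ^+ 2 * resolvent_moment (Kn n) 1 y) @[n --> \oo] -->
    c * (y ^+ 2 * resolvent_moment K 1 y).
  by apply: cvgM => //; apply: cvgM => //; exact: cvg_cst.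
rewrite /edge_excess; apply: cvgM.
  apply: cvgB; last exact: cvg_cst.
  apply: cvgM; last by apply: cvgV => //; rewrite gt_eqF.
  by apply: cvgM => //; exact: cvg_cst.
apply: cvgD; first exact: cvg_cst.
apply: cvgM => //; apply: cvgV; first by rewrite gt_eqF.
by apply: cvgB => //; apply: cvgD => //; exact: cvg_cst.
Unshelve. all: end_near. Qed.

(** Pointwise convergence of the excess suffices, since its sublevel set at 1 is
    closed upwards and the excess is strictly below 1 above the threshold. *)
Lemma cvg_Tthreshold (cn : nat -> R) c (Kn : nat -> CDF R) K :
  cn n @[n --> \oo] --> c -> 0 <= c <= 1 ->
  (\forall n \near \oo, 0 <= cn n <= 1) ->
  compactly_supported_nneg K -> (forall n, compactly_supported_nneg (Kn n)) ->
  cdf_weak_cvg Kn K -> Zplus (Kn n) @[n --> \oo] --> Zplus K ->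
  Tthreshold (cn n) (Kn n) @[n --> \oo] --> Tthreshold c K.
Proof.
move=> cc c01 cn01 sK sKn wK Zc; apply/cvgrPdist_le => e e0.
have cvgW y : Zplus K < y ->
    edge_excess (cn n) (Kn n) y @[n --> \oo] --> edge_excess c K y.
  by move=> Zy; exact: cvg_edge_excess.
have ZT := Zplus_le_Tthreshold sK c01.
have upper : \forall n \near \oo, Tthreshold (cn n) (Kn n) <= Tthreshold c K + e.
  have [y yS yT] := inf_adherent e0 (has_inf_threshold_set sK c01).
  have WT := edge_excess_lt1 sK c01 yS yT.
  have ZTe : Zplus K < Tthreshold c K + e by rewrite (le_lt_trans ZT)// ltrDl.
  near=> n; apply: Tthreshold_le => //; first by near: n.
    by near: n; exact: (cvgr_lt _ Zc).
  by near: n; exact: (cvgr_le _ (cvgW _ ZTe)).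
have lower : \forall n \near \oo, Tthreshold c K - e <= Tthreshold (cn n) (Kn n).
  (* Halving [e] leaves room for [Zplus (Kn n)] to stay slightly below its limit
     when the threshold is at the edge of the support. *)
  have [ZTe|TZe] := ltP (Zplus K) (Tthreshold c K - e / 2).
    have WT : 1 < edge_excess c K (Tthreshold c K - e / 2).
      rewrite ltNge; apply/negP => W1.
      by have := Tthreshold_le sK c01 ZTe W1; lra.
    near=> n; apply: (@le_trans _ _ (Tthreshold c K - e / 2)); first lra.
    apply: le_Tthreshold => //; first by near: n.
    by near: n; exact: (cvgr_gt _ (cvgW _ ZTe)).
  near=> n; apply: le_trans (Zplus_le_Tthreshold _ _) => //; last by near: n.
  apply: ltW; near: n; apply: (cvgr_gt _ Zc); lra.
near=> n; rewrite ler_distlC; apply/andP; split; by near: n.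
Unshelve. all: end_near. Qed.

End Threshold.

Lemma ceil_ratio_itv {R : realType} (gamma : R) (n : nat) :
  0 < gamma -> gamma <= 1 -> (0 < n)%N ->
  gamma <= (Num.ceil (gamma * n%:R))%:~R / n%:R <= Num.min 1 (gamma + n%:R^-1).
Proof.
move=> g0 g1 n0; have n0' : 0 < n%:R :> R by rewrite ltr0n.
rewrite ler_pdivlMr// ceil_ge/= le_min; apply/andP; split.
  rewrite ler_pdivrMr// mul1r -[n%:R]/((n%:Z)%:~R) ler_int ceil_le_int.
  by rewrite -[leRHS]mul1r ler_wpM2r.
rewrite ler_pdivrMr// mulrDl mulVf ?gt_eqF//.
have := ceilB1_lt (gamma * n%:R); rewrite intrB => h; lra.
Qed.

Theorem lemma3 (R : realType) (gamma : R) (p : nat -> int)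
    (H : CDF R) (Hn : nat -> CDF R)
    (gamma_gt0 : 0 < gamma) (gamma_le1 : gamma <= 1)
    (p_def : forall n : nat, p n = Num.ceil (gamma * n%:R))
    (H_supp : compactly_supported_nneg H)
    (H_edge : (\int[lebesgue_stieltjes_measure H]_(z in setT)
                 ((y - z) ^- 2)%:E)%E @[y --> (Zplus H)^'+] --> +oo%E)
    (Hn_supp : forall n : nat, compactly_supported_nneg (Hn n))
    (Hn_cvg : cdf_weak_cvg Hn H)
    (Zn_cvg : Zplus (Hn n) @[n --> \oo] --> Zplus H) :
  Tthreshold ((p n)%:~R / n%:R) (Hn n) @[n --> \oo] --> Tthreshold gamma H.
Proof.
have pn n : (0 < n)%N ->
    gamma <= (p n)%:~R / n%:R <= Num.min 1 (gamma + n%:R^-1).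
  by move=> n0; rewrite p_def ceil_ratio_itv.
apply: (@cvg_Tthreshold R (fun n => (p n)%:~R / n%:R)) => //.
- apply: (@squeeze_cvgr _ _ _ _ (cst gamma) (fun n => gamma + n%:R^-1)).
  + near=> n; have n0 : (0 < n)%N by near: n; exists 1%N.
    have /andP[-> /=] := pn n n0.
    by rewrite le_min => /andP[].
  + exact: cvg_cst.
  + rewrite -[X in _ --> X]addr0; apply: cvgD; first exact: cvg_cst.
    by rewrite gtr0_cvgV0; [exact: cvgr_idn|near=> n; rewrite ltr0n; near: n; exists 1%N].
- by rewrite ltW.
- near=> n; have n0 : (0 < n)%N by near: n; exists 1%N.
    have /andP[h /=] := pn n n0.
  by rewrite le_min => /andP[-> _]; rewrite (le_trans (ltW gamma_gt0)).
Unshelve. all: end_near. Qed.
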